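(* For every integer $n\ge 4$, $$\overline{\mathrm{dist}}_F(\mathcal{DD}_n^*,\mathcal{S}^n_+)=\overline{\mathrm{dist}}_F(\mathcal{SDD}_n^*,\mathcal{S}^n_+)=\frac{n-2}{n}.$$
   Context: Let $\mathbb{S}^n$ be the space of real symmetric $n\times n$ matrices with inner product $\langle A,B\rangle=\sum_{i,j=1}^n A_{i,j}B_{i,j}$ and Frobenius norm $\|X\|_F=\sqrt{\langle X,X\rangle}$. Let $\mathcal{S}^n_+=\{X\in\mathbb{S}^n\mid d^TXd\ge 0 \text{ for all } d\in\mathbb{R}^n\}$ be the positive semidefinite cone. Define $$\mathcal{DD}_n^*:=\{X\in\mathbb{S}^n\mid X_{i,i}+X_{j,j}\pm 2X_{i,j}\ge 0\ (1\le i\le j\le n)\}$$ (both sign choices are required), and $$\mathcal{SDD}_n^*:=\{X\in\mathbb{S}^n\mid X_{i,i}X_{j,j}\ge X_{i,j}^2\ (1\le i<j\le n),\ X_{i,i}\ge 0\ (i=1,\ldots,n)\}.$$ Let $\mathrm{P}_{\mathcal{S}^n_+}(X):=\mathrm{argmin}_{Y\in\mathcal{S}^n_+}\|X-Y\|_F$ be the metric projection of $X$ onto $\mathcal{S}^n_+$. For a set $\mathcal{S}$ with $\mathcal{S}^n_+\subseteq\mathcal{S}\subseteq\mathbb{S}^n$, the norm normalized distance is $$\overline{\mathrm{dist}}_F(\mathcal{S},\mathcal{S}^n_+):=\sup_{X\in\mathcal{S},\ \|X\|_F=1}\|X-\mathrm{P}_{\mathcal{S}^n_+}(X)\|_F.$$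 *)

(* Defs.v *)
From HB Require Import structures.
From mathcomp Require Import all_boot all_order all_algebra.
From mathcomp Require Import all_classical all_reals all_analysis.

Set Implicit Arguments.
Unset Strict Implicit.
Unset Printing Implicit Defensive.

Import Order.TTheory GRing.Theory Num.Theory.
Local Open Scope classical_set_scope.
Local Open Scope ring_scope.

Definition symmx (R : realType) (n : nat) : set 'M[R]_n :=
  [set X | X^T = X].

Definition inner (R : realType) (n : nat) (A B : 'M[R]_n) : R :=
  \sum_(i < n) \sum_(j < n) A i j * B i j.

(* MathComp-Analysis equips matrices with the sup norm `|X|, so the Frobenius
   norm is a separate function. *)
Definition frob (R : realType) (n : nat) (X : 'M[R]_n) : R :=
  Num.sqrt (inner X X).

Definition psd (R : realType) (n : nat) : set 'M[R]_n :=
  [set X | symmx X /\ forall d : 'cV[R]_n, 0 <= (d^T *m X *m d) 0 0].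

(* The case i = j gives 4 * X i i >= 0 (and the trivial 0 >= 0). *)
Definition dd_dual (R : realType) (n : nat) : set 'M[R]_n :=
  [set X | symmx X /\
    forall i j : 'I_n, (i <= j)%N ->
      0 <= X i i + X j j + 2 * X i j /\ 0 <= X i i + X j j - 2 * X i j].

Definition sdd_dual (R : realType) (n : nat) : set 'M[R]_n :=
  [set X | [/\ symmx X,
    forall i j : 'I_n, (i < j)%N -> X i j ^+ 2 <= X i i * X j j &
    forall i : 'I_n, 0 <= X i i]].

Definition frob_argmin (R : realType) (n : nat) (K : set 'M[R]_n)
    (X : 'M[R]_n) : set 'M[R]_n :=
  [set Y | K Y /\ forall Z, K Z -> frob (X - Y) <= frob (X - Z)].

(* The default value 0 is only used when frob_argmin K X is empty, which does
   not happen for the nonempty closed convex cone K = psd; in that case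
   frob_argmin K X is moreover a singleton. *)
Definition proj (R : realType) (n : nat) (K : set 'M[R]_n) (X : 'M[R]_n) :
  'M[R]_n := xget 0 (frob_argmin K X).

(* The supremum is taken in the extended reals, where it always exists. *)
Definition norm_dist (R : realType) (n : nat) (S K : set 'M[R]_n) : \bar R :=
  ereal_sup [set (frob (X - proj K X))%:E | X in S `&` [set X | frob X = 1]].

Arguments symmx R n : clear implicits.
Arguments psd R n : clear implicits.
Arguments dd_dual R n : clear implicits.
Arguments sdd_dual R n : clear implicits.

(* Main.v *)
Require Import Defs.
From HB Require Import structures.
From mathcomp Require Import all_boot all_order all_algebra.
From mathcomp Require Import all_classical all_reals all_analysis.
From mathcomp Require Import ring lra.
Import Order.TTheory GRing.Theory Num.Theory numFieldNormedType.Exports.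
Local Open Scope classical_set_scope.
Local Open Scope ring_scope.

(** Write [N] for the dimension, [<_, _>] for the inner product, [J] for the
    all-ones matrix and [I] for the identity.

    Upper bound.  Every [X] in [dd_dual] is within [(N - 2) / N * frob X] of one
    explicit positive semidefinite [P]: shrink the off-diagonal entries of [X]
    by the factor [2 / N], and replace each diagonal entry [X i i] by
    [((N - 2) X i i + A) / N], with [A] the trace.  The inequalities
    [2 |X i j| <= X i i + X j j], summed over [j], say exactly that [P] is
    diagonally dominant, hence positive semidefinite.  The off-diagonal part of
    [X - P] is [(N - 2) / N] times that of [X].  Its diagonal entries are
    [(2 X i i - A) / N], and the bound on their sum of squares reduces to
    [(N - 4) A^2 <= (N - 4) N (sum of the X i i ^2)]: Cauchy-Schwarz when
    [4 <= N] ([dd_dual_near_psd]).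

    Lower bound.  The matrix [(2 I - J) / N] has norm [1] and lies in [sdd_dual].
    A positive semidefinite [Z] has [<Z, J> >= 0], while
    [<2 I - J, J> / N = 2 - N]; since [J] has norm [N], Cauchy-Schwarz keeps
    every such [Z] at distance at least [(N - 2) / N] ([worst_mx_far]).

    As [sdd_dual] is contained in [dd_dual], the two bounds give the same value
    for every set in between ([norm_dist_between]).  They speak of arbitrary
    positive semidefinite matrices; to transfer them to the metric projection it
    remains to know that a nearest point exists, which is a compactness argument
    ([frob_argmin_nonempty]). *)

(** * Sums of squares and the Frobenius norm *)

(** Cauchy-Schwarz against the constant function [1], obtained from the
    nonnegativity of the variance of [f], scaled by [#|I|] so that no division
    is needed. *)
Lemma sqr_sum_le_card {R : realFieldType} {I : finType} (f : I -> R) :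
  (\sum_i f i) ^+ 2 <= #|I|%:R * \sum_i f i ^+ 2.
Proof.
set A := \sum_i f i; set B := \sum_i f i ^+ 2; set m : R := #|I|%:R.
have variance : \sum_i (m * f i - A) ^+ 2 = m * (m * B - A ^+ 2).
  under eq_bigr do rewrite sqrrB exprMn.
  rewrite big_split big_split /= sumr_const -[A ^+ 2 *+ _]mulr_natl.
  rewrite -mulr_sumr sumrN -/B.
  have -> : \sum_i m * f i * A *+ 2 = 2 * m * A * A.
    by rewrite {3}/A mulr_sumr; apply: eq_bigr => i _; ring.
  rewrite -/m; ring.
have [I0|I_gt0] := posnP #|I|.
  have noI (i : I) : False by have := fintype0 i; rewrite I0 => /(_ erefl).
  by rewrite /A big1 => [|i]; [rewrite expr0n /m I0 mul0r|case: (noI i)].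
have m_gt0 : 0 < m by rewrite ltr0n.
by rewrite -subr_ge0 -(pmulr_rge0 _ m_gt0) -variance sumr_ge0 // => i _; exact: sqr_ge0.
Qed.

Lemma inner_ge0 {R : realType} {n} (M : 'M[R]_n) : 0 <= inner M M.
Proof. by do 2![apply: sumr_ge0 => ? _]; rewrite -expr2 sqr_ge0. Qed.

Lemma sqr_frob {R : realType} {n} (M : 'M[R]_n) : frob M ^+ 2 = inner M M.
Proof. by rewrite sqr_sqrtr ?inner_ge0. Qed.

Lemma frob_ge0 {R : realType} {n} (M : 'M[R]_n) : 0 <= frob M.
Proof. exact: sqrtr_ge0. Qed.

Lemma frob_le {R : realType} {n} (M : 'M[R]_n) (c : R) :
  0 <= c -> (frob M <= c) = (inner M M <= c ^+ 2).
Proof. by move=> c0; rewrite -sqr_frob ler_pXn2r ?nnegrE ?sqrtr_ge0. Qed.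

Lemma inner_diagD {R : realType} {n} (M : 'M[R]_n) :
  inner M M = \sum_i M i i ^+ 2 + \sum_i \sum_(j | j != i) M i j ^+ 2.
Proof.
rewrite /inner -big_split; apply: eq_bigr => i _ /=.
by rewrite (bigD1 i) //= -expr2; congr (_ + _); apply: eq_bigr => j _; rewrite expr2.
Qed.

Lemma entry_le_frob {R : realType} {n} (M : 'M[R]_n) i j : `|M i j| <= frob M.
Proof.
rewrite -sqrtr_sqr ler_wsqrtr // /inner (bigD1 i) //= (bigD1 j) //= -expr2.
rewrite -addrA lerDl addr_ge0 //; apply: sumr_ge0 => k _; rewrite -?expr2 ?sqr_ge0 //.
by apply: sumr_ge0 => l _; rewrite -expr2 sqr_ge0.
Qed.

(** Cauchy-Schwarz against the all-ones matrix, whose Frobenius norm is [n]. *)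
Lemma sqr_sum_mx_le {R : realType} {n} (M : 'M[R]_n) :
  (\sum_i \sum_j M i j) ^+ 2 <= n%:R ^+ 2 * inner M M.
Proof.
have := @sqr_sum_le_card R ('I_n * 'I_n)%type (fun p => M p.1 p.2).
rewrite card_prod card_ord natrM -expr2.
rewrite -(pair_bigA _ (fun i j => M i j)) -(pair_bigA _ (fun i j => M i j ^+ 2)) /=.
suff -> : inner M M = \sum_i \sum_j M i j ^+ 2 by [].
by apply: eq_bigr => i _; apply: eq_bigr => j _; rewrite expr2.
Qed.

(** * Existence of nearest points *)

Lemma continuous_vec_mx {R : realType} {m n} :
  continuous (@vec_mx R m n : 'rV[R]_(m * n) -> 'M[R]_(m, n)).
Proof.
move=> v s /nbhs_ballP[e e0 es]; apply/nbhs_ballP; exists e => //= w [_ vw].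
by apply: es; split => // i j; rewrite !mxE; exact: vw.
Qed.

Lemma continuous_big_sum (T : topologicalType) (R : realType) (I : finType)
    (f : I -> T -> R) :
  (forall i, continuous (f i)) -> continuous (fun x => \sum_i f i x).
Proof.
move=> fc x; apply: cvg_big => [|i _]; last exact: fc.
by apply: add_continuous.
Qed.

Lemma continuous_frob_sub {R : realType} {n} (X : 'M[R]_n) :
  continuous (fun Z : 'M[R]_n => frob (X - Z)).
Proof.
move=> Z; apply: (@continuous_comp 'M[R]_n R R (fun Z => inner (X - Z) (X - Z)) (@Num.sqrt R)).
  apply: continuous_big_sum => i; apply: continuous_big_sum => j {}Z.
  have entry_cvg : (X - W) i j @[W --> Z] --> (X - Z) i j.
    under eq_fun do rewrite !mxE.
    rewrite !mxE; exact: cvgB (cvg_cst (X i j)) (@coord_continuous R n n i j Z).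
  exact: (cvgM entry_cvg entry_cvg).
exact: (@sqrt_continuous R).
Qed.

(** Only the points of [K] at distance at most [b] from [X] matter, for [b] the
    distance to some point of [K].  They lie in the box of matrices whose entries
    differ from those of [X] by at most [b], which is compact by Tychonoff once
    matrices are flattened into row vectors; the distance attains its minimum
    there. *)
Lemma frob_argmin_nonempty {R : realType} {n} (K : set 'M[R]_n) (X : 'M[R]_n) :
  closed K -> K !=set0 -> frob_argmin K X !=set0.
Proof.
move=> Kcl [Z0 KZ0].
pose b := frob (X - Z0).
pose box := [set v : 'rV[R]_(n * n) |
  forall k, `[mxvec X ord0 k - b, mxvec X ord0 k + b]%classic (v ord0 k)].
have boxP Z : frob (X - Z) <= b -> box (mxvec Z).
  move=> XZb k /=; case/mxvec_indexP: k => i j; rewrite !mxvecE in_itv /=.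
  have := le_trans (entry_le_frob (X - Z) i j) XZb.
  by rewrite !mxE ler_norml => /andP[? ?]; lra.
have box_compact : compact box.
  apply: (@rV_compact R _ (fun k => `[mxvec X ord0 k - b, mxvec X ord0 k + b]%classic)).
  by move=> k; exact: segment_compact.
have boxK_compact : compact (box `&` vec_mx @^-1` K).
  apply: (subclosed_compact _ box_compact); last by move=> v [].
  apply: closedI; first by apply: (compact_closed _ box_compact); exact: norm_hausdorff.
  by apply: preimage_closed => // v _; exact: continuous_vec_mx.
have [||v] := @compact_EVT_min _ _ (fun v => frob (X - vec_mx v)) _ _ boxK_compact.
- by exists (mxvec Z0); split => /=; [exact: boxP|rewrite mxvecK].
- apply: continuous_subspaceT => v.
  apply: (@continuous_comp 'rV[R]_(n * n) 'M[R]_n R vec_mx (fun Z => frob (X - Z))).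
    exact: continuous_vec_mx.
  exact: continuous_frob_sub.
rewrite inE => -[_ Kv] vmin; exists (vec_mx v); split => // Z KZ.
(* [v] minimizes over the points of [K] in the box; outside the box the distance exceeds [b], the
   distance to [Z0], which lies in the box. *)
have vmin' Y : K Y -> frob (X - Y) <= b -> frob (X - vec_mx v) <= frob (X - Y).
  move=> KY /boxP boxY; have := vmin (mxvec Y); rewrite mxvecK; apply.
  by rewrite inE; split => //=; rewrite mxvecK.
have [/vmin'|/ltW] := leP (frob (X - Z)) b; first exact.
by apply: le_trans; exact: vmin'.
Qed.

(** * The cone of positive semidefinite matrices *)

Lemma quadE {R : realType} {n} (Z : 'M[R]_n) (d : 'cV[R]_n) :
  (d^T *m Z *m d) 0 0 = \sum_i \sum_j d i 0 * Z i j * d j 0.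
Proof.
rewrite mxE exchange_big /=; apply: eq_bigr => j _.
by rewrite mxE mulr_suml; apply: eq_bigr => i _; rewrite !mxE.
Qed.

Lemma closed_nonneg {T : topologicalType} {R : realType} {f : T -> R} :
  continuous f -> closed [set x | 0 <= f x].
Proof. by move=> fc; exact: ((continuous_closedP f).1 fc _ (@closed_ge R 0)). Qed.

(** An intersection of closed half-spaces: symmetry amounts to the inequalities
    [X j i <= X i j], and each [d] contributes one linear inequality in [X]. *)
Lemma psd_closed {R : realType} {n} : closed (psd R n).
Proof.
have -> : psd R n = [set X : 'M[R]_n | forall i j, 0 <= X i j - X j i] `&`
    [set X | forall d : 'cV[R]_n, 0 <= (d^T *m X *m d) 0 0] :> set 'M[R]_n.
  apply/seteqP; split=> X [symX psdX]; split => //.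
    by move=> i j /=; rewrite -{1}symX mxE subrr.
  by apply/matrixP => i j; rewrite mxE; have := symX i j; have := symX j i; lra.
apply: closedI.
  have -> : [set X : 'M[R]_n | forall i j, 0 <= X i j - X j i] =
      \bigcap_(p in [set: 'I_n * 'I_n]) [set X : 'M[R]_n | 0 <= X p.1 p.2 - X p.2 p.1].
    by apply/seteqP; split=> X /= symX; [move=> p _|move=> i j]; [exact: symX|exact: (symX (i, j) I)].
  apply: closed_bigI => p _.
  apply: closed_nonneg => X.
  exact: cvgB (@coord_continuous R n n p.1 p.2 X) (@coord_continuous R n n p.2 p.1 X).
have -> : [set X : 'M[R]_n | forall d : 'cV[R]_n, 0 <= (d^T *m X *m d) 0 0] =
    \bigcap_(d in [set: 'cV[R]_n]) [set X : 'M[R]_n | 0 <= (d^T *m X *m d) 0 0].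
  by apply/seteqP; split=> X psdX d; [move=> _; exact: psdX|exact: (psdX d I)].
apply: closed_bigI => d _.
apply: closed_nonneg; under eq_fun do rewrite quadE.
apply: continuous_big_sum => i; apply: continuous_big_sum => j {}X.
exact: cvgM (cvgM (cvg_cst (d i 0)) (@coord_continuous R n n i j X)) (cvg_cst (d j 0)).
Qed.

Lemma psd0 {R : realType} {n} : psd R n 0.
Proof. by split=> [|d]; [exact: trmx0|rewrite mulmx0 mul0mx mxE]. Qed.

Lemma proj_psdP {R : realType} {n} (X : 'M[R]_n) :
  frob_argmin (psd R n) X (Defs.proj (psd R n) X).
Proof.
have [Y XY] := frob_argmin_nonempty (psd R n) X psd_closed (ex_intro _ _ psd0).
exact: (xgetI 0 XY).
Qed.

(** The sum of the entries is the quadratic form at the all-ones vector. *)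
Lemma psd_sum_entries_ge0 {R : realType} {n} {Z : 'M[R]_n} :
  psd R n Z -> 0 <= \sum_i \sum_j Z i j.
Proof.
move=> [_ /(_ (const_mx 1))]; rewrite quadE.
by under eq_bigr do under eq_bigr do rewrite !mxE mul1r mulr1.
Qed.

(** Each off-diagonal term of the quadratic form is at least
    [- |Z i j| (d i ^2 + d j ^2) / 2].  By symmetry these lower bounds add up
    to [- sum_i d i ^2 (sum_(j != i) |Z i j|)], which the diagonal absorbs. *)
Lemma diag_dominant_psd {R : realType} {n} {Z : 'M[R]_n} :
  Z^T = Z -> (forall i, \sum_(j | j != i) `|Z i j| <= Z i i) -> psd R n Z.
Proof.
move=> symZ domZ; split => // d; rewrite quadE.
have ZC i j : Z j i = Z i j by rewrite -[in LHS]symZ mxE.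
pose q i j := `|Z i j| * d i 0 ^+ 2.
have qC : \sum_i \sum_(j | j != i) q j i = \sum_i \sum_(j | j != i) q i j.
  rewrite (exchange_big_dep xpredT) //=; apply: eq_bigr => i _.
  by apply: eq_bigl => j; rewrite eq_sym.
have -> : \sum_i \sum_j d i 0 * Z i j * d j 0 = \sum_i Z i i * d i 0 ^+ 2 +
    \sum_i \sum_(j | j != i) d i 0 * Z i j * d j 0.
  rewrite -big_split; apply: eq_bigr => i _ /=.
  by rewrite (bigD1 i) //=; congr (_ + _); ring.
(* Splitting [q i j] as [(q i j + q j i) / 2] makes the bound hold termwise. *)
have off_ge : - \sum_i \sum_(j | j != i) q i j <=
    \sum_i \sum_(j | j != i) d i 0 * Z i j * d j 0.
  have -> : - \sum_i \sum_(j | j != i) q i j =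
      \sum_i \sum_(j | j != i) - ((q i j + q j i) / 2).
    under [RHS]eq_bigr do rewrite sumrN -mulr_suml big_split /=.
    rewrite sumrN -mulr_suml big_split /= qC; lra.
  apply: ler_sum => i _; apply: ler_sum => j _; rewrite /q ZC.
  have := lexx `|Z j i|; rewrite ler_norml => /andP[].
  have := sqr_ge0 (d i 0 + d j 0); have := sqr_ge0 (d i 0 - d j 0); nra.
apply: le_trans (lerD (lexx _) off_ge); rewrite subr_ge0.
apply: ler_sum => i _; rewrite /q -mulr_suml.
by rewrite ler_wpM2r ?sqr_ge0.
Qed.

(** * The two bounds on the distance *)

(** [2 sqrt (a b) <= a + b] for nonnegative [a] and [b]. *)
Lemma sdd_dual_sub_dd_dual {R : realType} {n} : sdd_dual R n `<=` dd_dual R n.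
Proof.
move=> X [symX minorX diagX]; split => // i j.
rewrite leq_eqVlt => /predU1P[/val_inj ->|/minorX Xij].
  by have := diagX j; lra.
have := diagX i; have := diagX j.
move: (X i i) (X j j) (X i j) Xij => a b x xab b0 a0.
suff : `|2 * x| <= a + b by rewrite ler_norml => /andP[? ?]; lra.
rewrite -(@ler_pXn2r _ 2) ?nnegrE ?addr_ge0 // real_normK ?num_real //.
by have := sqr_ge0 (a - b); nra.
Qed.

(** The diagonal of [P] is the smallest one for which the inequalities defining
    [dd_dual] ensure diagonal dominance: its [i]-th entry is the sum over
    [j != i] of [(X i i + X j j) / n], which bounds the sum of the
    [2 / n * |X i j|]. *)
Lemma dd_dual_near_psd {R : realType} {n} {X : 'M[R]_n} :
  (4 <= n)%N -> dd_dual R n X ->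
  exists2 P, psd R n P & frob (X - P) <= (n%:R - 2) / n%:R * frob X.
Proof.
move=> n4 [symX ddX]; set N : R := n%:R.
have N4 : 4 <= N by rewrite ler_nat.
have XC i j : X j i = X i j by rewrite -[in LHS]symX mxE.
have ddX' i j : `|X i j| <= (X i i + X j j) / 2.
  rewrite ler_norml.
  by have [/ddX[]|/ltnW/ddX[]] := leqP i j; rewrite ?(XC i j); lra.
have diagX i : 0 <= X i i by have := le_trans (normr_ge0 _) (ddX' i i); lra.
pose A := \sum_i X i i.
pose P := \matrix_(i, j)
  if i == j then ((N - 2) * X i i + A) / N else 2 / N * X i j.
exists P.
  apply: diag_dominant_psd => [|i].
    by apply/matrixP => i j; rewrite !mxE eq_sym; case: eqP => [->|_] //; rewrite XC.
  have -> : P i i = \sum_(j | j != i) (X i i + X j j) / N.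
    rewrite mxE eqxx -mulr_suml big_split /= sumr_const cardC1 card_ord /A.
    rewrite (bigD1 i) //= -[X i i *+ _]mulr_natl -subn1 natrB ?(leq_trans _ n4) // -/N.
    by congr (_ / _); ring.
  apply: ler_sum => j ji; rewrite mxE eq_sym (negPf ji) normrM ger0_norm ?divr_ge0 ?ler0n //.
  by rewrite mulrAC ler_pM2r ?invr_gt0; have := ddX' i j; lra.
have c0 : 0 <= (N - 2) / N by rewrite divr_ge0; lra.
rewrite frob_le; last exact: mulr_ge0 c0 (frob_ge0 X).
rewrite exprMn sqr_frob !inner_diagD mulrDr.
apply: lerD.
  (* The cross terms [- 4 A X i i] sum to [- 4 A^2]; this is where [n - 4] arises. *)
  have -> : \sum_i (X - P) i i ^+ 2 = ((N - 4) * A ^+ 2 + 4 * \sum_i X i i ^+ 2) / N ^+ 2.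
    transitivity (\sum_i (A ^+ 2 - 4 * A * X i i + 4 * X i i ^+ 2) / N ^+ 2).
      by apply: eq_bigr => i _; rewrite !mxE eqxx; field; lra.
    rewrite -mulr_suml; congr (_ / _).
    rewrite !big_split /= sumr_const card_ord -mulr_natl -/N sumrN -!mulr_sumr -/A.
    by ring.
  have := @sqr_sum_le_card R 'I_n (fun i => X i i); rewrite card_ord -/A -/N.
  rewrite expr_div_n mulrAC ler_pM2r ?invr_gt0 ?exprn_gt0; [|lra..].
  by move: (A ^+ 2) (\sum_i _) => a s; nra.
rewrite mulr_sumr; apply: ler_sum => i _; rewrite mulr_sumr; apply: ler_sum => j ji.
rewrite !mxE eq_sym (negPf ji) -exprMn le_eqVlt; apply/orP; left; apply/eqP.
by congr (_ ^+ 2); field; lra.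
Qed.

(** This is [(2 I - J) / n]; for [2 < n] its only negative eigenvalue, [(2 - n) / n], has
    the all-ones vector as eigenvector. *)
Definition worst_mx (R : realType) n : 'M[R]_n :=
  \matrix_(i, j) ((if i == j then 1 else -1) / n%:R).

Lemma worst_mx_sdd {R : realType} {n} : sdd_dual R n (worst_mx R n).
Proof.
split=> [|i j ij|i]; first by apply/matrixP => i j; rewrite !mxE eq_sym.
  rewrite !mxE !eqxx (_ : i == j = false); last by apply/eqP => eij; rewrite eij ltnn in ij.
  by rewrite mulN1r sqrrN expr2 mul1r.
by rewrite mxE eqxx divr_ge0 // ler0n.
Qed.

Lemma frob_worst_mx {R : realType} {n} : (0 < n)%N -> frob (worst_mx R n) = 1.
Proof.
move=> n0; have N0 : n%:R != 0 :> R by rewrite pnatr_eq0 -lt0n.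
have -> : frob (worst_mx R n) = Num.sqrt (\sum_(i < n) \sum_(j < n) n%:R^-1 ^+ 2).
  congr Num.sqrt; apply: eq_bigr => i _; apply: eq_bigr => j _.
  by rewrite mxE; case: ifP => _; ring.
rewrite !sumr_const card_ord -mulrnA -[X in Num.sqrt X]mulr_natl natrM.
by rewrite (_ : _ * _ = 1) ?sqrtr1 //; field.
Qed.

(** Pairing with the all-ones matrix separates [worst_mx] from the cone: the
    entries of [worst_mx] sum to [2 - n], those of [Z] to a nonnegative number. *)
Lemma worst_mx_far {R : realType} {n} {Z : 'M[R]_n} :
  (2 <= n)%N -> psd R n Z -> (n%:R - 2) / n%:R <= frob (worst_mx R n - Z).
Proof.
move=> n2 psdZ; set N : R := n%:R.
have N2 : 2 <= N by rewrite ler_nat.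
have sum_worst : \sum_i \sum_j worst_mx R n i j = 2 - N.
  transitivity (\sum_(i < n) (2 - N) / N).
    apply: eq_bigr => i _; under eq_bigr do rewrite mxE.
    rewrite -mulr_suml (bigD1 i) //= eqxx.
    under eq_bigr => j ji do rewrite eq_sym (negPf ji).
    rewrite sumr_const cardC1 card_ord mulNrn -subn1 natrB ?(ltnW n2) //.
    by rewrite -/N; congr (_ / _); ring.
  by rewrite sumr_const card_ord -mulr_natl -/N; field; lra.
have c0 : 0 <= N * frob (worst_mx R n - Z) by rewrite mulr_ge0 ?frob_ge0; lra.
have := sqr_sum_mx_le (worst_mx R n - Z); rewrite -/N -sqr_frob -exprMn -ler_sqrt ?sqr_ge0 //.
rewrite !sqrtr_sqr (ger0_norm c0).
have -> : \sum_i \sum_j (worst_mx R n - Z) i j = 2 - N - \sum_i \sum_j Z i j.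
  rewrite -sum_worst -sumrB; apply: eq_bigr => i _.
  by rewrite -sumrB; apply: eq_bigr => j _; rewrite mxE [in X in _ + X]mxE.
rewrite ler_norml ler_pdivrMr ?(lt_le_trans _ N2) // => /andP[+ _].
by have := psd_sum_entries_ge0 psdZ; lra.
Qed.

(** The supremum is monotone in the set, the upper bound holds on all of
    [dd_dual], and [worst_mx] already lies in [sdd_dual]. *)
Lemma norm_dist_between {R : realType} {n} {S : set 'M[R]_n} :
  (4 <= n)%N -> sdd_dual R n `<=` S -> S `<=` dd_dual R n ->
  norm_dist S (psd R n) = ((n%:R - 2) / n%:R)%:E.
Proof.
move=> n4 sddS Sdd; apply/eqP; rewrite eq_le; apply/andP; split.
  apply: ge_ereal_sup => _ [X [SX X1] <-]; rewrite lee_fin.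
  have [P psdP XP] := dd_dual_near_psd n4 (Sdd _ SX).
  have [_ /(_ P psdP) projX] := proj_psdP X.
  by rewrite (le_trans projX) // (le_trans XP) // X1 mulr1.
apply: (@le_trans _ _ (frob (worst_mx R n - Defs.proj (psd R n) (worst_mx R n)))%:E).
  by rewrite lee_fin worst_mx_far ?(leq_trans _ n4) //; have [] := proj_psdP (worst_mx R n).
apply: ereal_sup_ubound; exists (worst_mx R n) => //; split; first exact/sddS/worst_mx_sdd.
by rewrite /= frob_worst_mx // (leq_trans _ n4).
Qed.

Theorem theorem1 (R : realType) (n : nat) (hn : (4 <= n)%N) :
  norm_dist (dd_dual R n) (psd R n) = norm_dist (sdd_dual R n) (psd R n) /\
  norm_dist (sdd_dual R n) (psd R n) = ((n%:R - 2) / n%:R : R)%:E.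
Proof.
have sddE := norm_dist_between hn (@subset_refl _ _) (@sdd_dual_sub_dd_dual R n).
by rewrite sddE (norm_dist_between hn (@sdd_dual_sub_dd_dual R n) (@subset_refl _ _)).
Qed.
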